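(* Let $G$ be any group, let $K$ be a field, let $n_1,\ldots,n_t$ be positive integers, and let $A=UT(n_1,n_2,\ldots,n_t)$ be the upper block triangular matrix algebra over $K$, endowed with an arbitrary $G$-grading. Suppose that either $\operatorname{char}K=0$ or $\operatorname{char}K>\dim_K A$. Then there exist a $G$-grading on a matrix algebra $D=M_n(K)$ making $D$ a graded division algebra, and an upper block triangular matrix algebra $B=UT(n_1',n_2',\ldots,n_t')$ over $K$ endowed with an elementary grading given by some sequence $(g_1,\ldots,g_m)\in G^m$, $m=n_1'+\cdots+n_t'$, such that $A\cong B\otimes_K D$ as $G$-graded algebras, where the grading on $B\otimes_K D$ is given by $\deg(e_{ij}\otimes d)=g_i(\deg d)g_j^{-1}$ for every matrix unit $e_{ij}\in B$ and every nonzero homogeneous $d\in D$.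
   Context: For positive integers $n_1,\ldots,n_t$, $UT(n_1,\ldots,n_t)$ denotes the $K$-algebra of block matrices $(A_{ij})_{1\le i,j\le t}$, where $A_{ij}$ is an $n_i\times n_j$ matrix with entries in $K$ and $A_{ij}=0$ for $i>j$. A $G$-grading on a $K$-algebra $A$ ($G$ written multiplicatively, not necessarily commutative or finite) is a vector space decomposition $A=\bigoplus_{g\in G}A_g$ (some $A_g$ may be zero) with $A_gA_h\subset A_{gh}$ for all $g,h\in G$. Elements of $\bigcup_g A_g$ are homogeneous, and $\deg x=g$ means that $x\in A_g$ (for $x\neq 0$). An isomorphism of $G$-graded algebras is an algebra isomorphism $\varphi:A\to A'$ with $\varphi(A_g)=A'_g$ for all $g\in G$. A graded division algebra is a (unital associative) graded algebra in which every nonzero homogeneous element is invertible. A $G$-grading on $M_m(K)$, or on an upper block triangular subalgebra $UT(n_1',\ldots,n_t')\subset M_m(K)$ with $m=n_1'+\cdots+n_t'$, is elementary, given by the sequence $(g_1,\ldots,g_m)\in G^m$, if every matrix unit $e_{ij}$ in the algebra is homogeneous of degree $g_ig_j^{-1}$. *)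

(* Defs.v *)
From HB Require Import structures.
From mathcomp Require Import all_boot all_order all_algebra.
From mathcomp.real_closed Require Export mxtens.
Set Implicit Arguments.
Unset Strict Implicit.
Unset Printing Implicit Defensive.
Import GRing.Theory.
Local Open Scope ring_scope.

Section BlockTriangular.
Variables (K : fieldType) (t : nat) (n : 'I_t -> nat).

Definition UT : {vspace 'M[K]_(\sum_i n i)} :=
  (\bigcap_(p : 'I_t * 'I_t | (p.2 < p.1)%N)
     lker (linfun (fun M => submxblock M p.1 p.2)))%VS.

Lemma mem_UT M :
  M \in UT <-> (forall i j : 'I_t, (j < i)%N -> submxblock M i j = 0).
Proof.
have kerE i j :
    (M \in lker (linfun (fun M => submxblock M i j))) = (submxblock M i j == 0).
  by rewrite /submxblock memv_ker lfunE.
rewrite memvE; split=> [/subv_bigcapP H i j ji|H].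
  by have := H (i, j) ji; rewrite -memvE kerE => /eqP.
by apply/subv_bigcapP => -[i j] /= ji; rewrite -memvE kerE H.
Qed.

End BlockTriangular.
Arguments UT K {t} n.

(* Linear subspaces of M_p(K) tensor M_q(K), the latter realised as M_pq(K) by
   the Kronecker product.  The lemmas below show that this is the tensor product
   of U and V, and that of algebras by tensmx_mul. *)
Section Tensor.
Variable K : fieldType.

Definition tensv p q (U : {vspace 'M[K]_p}) (V : {vspace 'M[K]_q}) :
    {vspace 'M[K]_(p * q)} :=
  <<[seq x *t y | x <- vbasis U, y <- vbasis V]>>%VS.

Fact tensmxDl m n p q (A B : 'M[K]_(m, n)) (C : 'M[K]_(p, q)) a :
  (a *: A + B) *t C = a *: (A *t C) + B *t C.
Proof. by apply/matrixP=> i j; rewrite !mxE mulrDl mulrA. Qed.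

Fact tensmxDr m n p q (A : 'M[K]_(m, n)) (B C : 'M[K]_(p, q)) a :
  A *t (a *: B + C) = a *: (A *t B) + A *t C.
Proof. by apply/matrixP=> i j; rewrite !mxE mulrDr mulrCA. Qed.

Lemma mem_tensv p q (U : {vspace 'M[K]_p}) (V : {vspace 'M[K]_q}) x y :
  x \in U -> y \in V -> x *t y \in tensv U V.
Proof.
move=> xU yV; rewrite (coord_vbasis xU).
elim/big_rec: _ => [|i a _ IH]; first by rewrite tens0mx mem0v.
rewrite tensmxDl rpredD ?rpredZ // (coord_vbasis yV).
elim/big_rec: _ => [|j b _ IHb]; first by rewrite tensmx0 mem0v.
rewrite tensmxDr rpredD ?rpredZ // memv_span //.
by apply/allpairsP; exists ((vbasis U)`_i, (vbasis V)`_j);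
  split=> //=; rewrite mem_nth // size_tuple.
Qed.

Lemma tensv_free p q (U : {vspace 'M[K]_p}) (V : {vspace 'M[K]_q})
    (c : 'I_(\dim U) -> 'I_(\dim V) -> K) :
  \sum_i \sum_j c i j *: ((vbasis U)`_i *t (vbasis V)`_j) = 0 ->
  forall i j, c i j = 0.
Proof.
move=> H i j.
have fU : free (vbasis U) := basis_free (vbasisP U).
have fV : free (vbasis V) := basis_free (vbasisP V).
have E k l : \sum_j (\sum_i c i j * (vbasis U)`_i k l) *: (vbasis V)`_j = 0.
  apply/matrixP => a b; rewrite [RHS]mxE.
  have := congr1 (fun M : 'M[K]_(p * q) =>
    M (mxtens_index (k, a)) (mxtens_index (l, b))) H.
  rewrite [in RHS]mxE => {2}<-; rewrite exchange_big /= !summxE.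
  apply: eq_bigr => j' _; rewrite summxE mxE mulr_suml.
  by apply: eq_bigr => i' _; rewrite mxE tensmxE mulrA.
have F : \sum_i c i j *: (vbasis U)`_i = 0.
  apply/matrixP => k l; rewrite mxE summxE.
  by under eq_bigr do rewrite mxE; have /freeP := fV; move/(_ _ (E k l) j).
by have /freeP := fU; move/(_ _ F i).
Qed.

End Tensor.

Section Gradings.
Variables (G : groupType) (K : fieldType).

(* Gam g is the component of degree g of the subalgebra A of M_N(K); G may be
   infinite, so the direct sum is expressed through its finite subsums. *)
Definition is_grading N (A : {vspace 'M[K]_N}) (Gam : G -> {vspace 'M[K]_N}) :=
  [/\ forall g, (Gam g <= A)%VS,
      forall a, a \in A -> exists s : seq G, a \in (\sum_(g <- s) Gam g)%VS,
      forall s : seq G, uniq s -> directv (\sum_(g <- s) Gam g)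
    & forall g h a b, a \in Gam g -> b \in Gam h -> a *m b \in Gam (g * h)%g].

Definition graded_division d (Gam : G -> {vspace 'M[K]_d}) :=
  is_grading fullv Gam /\
  (forall g x, x \in Gam g -> x != 0 -> x \in unitmx).

Definition elementary N (B : {vspace 'M[K]_N}) (Gam : G -> {vspace 'M[K]_N})
    (gs : 'I_N -> G) :=
  is_grading B Gam /\
  (forall i j, delta_mx i j \in B -> delta_mx i j \in Gam (gs i * (gs j)^-1)%g).

(* The grading of B tensor M_d(K) induced by an elementary grading of B given by
   gs and a grading GamD of M_d(K).  Such a Gam is unique, as the
   e_ij *t x with x homogeneous span when B is spanned by matrix units. *)
Definition tensor_grading N d (B : {vspace 'M[K]_N}) (gs : 'I_N -> G)
    (GamD : G -> {vspace 'M[K]_d}) (Gam : G -> {vspace 'M[K]_(N * d)}) :=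
  is_grading (tensv B fullv) Gam /\
  (forall i j h x, delta_mx i j \in B -> x \in GamD h ->
     delta_mx i j *t x \in Gam (gs i * h * (gs j)^-1)%g).

(* A linear map between the subspaces A and A' is the restriction of a linear
   map f between the ambient matrix spaces; only f on A matters.  If A and
   A' are unital, f preserves the unit, being multiplicative and onto A'. *)
Definition graded_iso N N' (A : {vspace 'M[K]_N}) (Gam : G -> {vspace 'M[K]_N})
    (A' : {vspace 'M[K]_N'}) (Gam' : G -> {vspace 'M[K]_N'}) :=
  exists f : 'Hom('M[K]_N, 'M[K]_N'),
    [/\ {in A &, injective f}, (f @: A)%VS = A',
        {in A &, forall a b, f (a *m b) = f a *m f b}
      & forall g, (f @: Gam g)%VS = Gam' g].

End Gradings.

(* Main.v *)
From HB Require Import structures.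
From Stdlib Require Classical_Prop.
Require Import Defs.
From mathcomp Require Import all_boot all_order all_algebra.
Set Implicit Arguments.
Unset Strict Implicit.
Unset Printing Implicit Defensive.
Import GRing.Theory.
Local Open Scope ring_scope.

(* Left multiplication by a homogeneous element of degree g <> 1 maps every
   homogeneous component of A into a different one, so its trace on A is 0.
   In the given characteristic the Jacobson radical J is the radical of the form
   tr(L_(xy)), hence J is graded, and so are its right annihilator (the matrices
   supported on the first block row) and the flag of right submodules obtained
   by taking iterated annihilators of J.  A homogeneous matrix x of minimal rank d
   supported on the first block row and not in J generates a left ideal that
   contains a homogeneous idempotent e = C R with R C = 1.  Then eAe = C M_d R is
   a graded division algebra D = M_d, and eA = C M_(d,N) is a graded (D, A)-bimodule,
   with M_(d,N) = D-span of homogeneous w_1, ..., w_m adapted to the flag.  Stacking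
   the w_l gives an invertible matrix P, and a |-> P a P^-1 is the isomorphism of
   A with UT(n') tensor D, where g_l = (deg w_l)^-1. *)

(** * Direct sums of subspaces indexed by a sequence *)

Section SeqSums.
Variables (K : fieldType) (V : vectType K) (I : eqType) (U : I -> {vspace V}).

Lemma memv_sum_seq (s : seq I) (u : I -> V) :
  (forall i, i \in s -> u i \in U i) -> \sum_(i <- s) u i \in (\sum_(i <- s) U i)%VS.
Proof.
elim: s => [|i s IH] Hu; first by rewrite !big_nil mem0v.
rewrite !big_cons memv_add ?Hu ?mem_head // IH // => j js.
by rewrite Hu // inE js orbT.
Qed.

Lemma memv_sum_seqP (s : seq I) v : uniq s -> v \in (\sum_(i <- s) U i)%VS ->
  exists2 u : I -> V, forall i, u i \in U i & v = \sum_(i <- s) u i.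
Proof.
move=> us vs; exists (fun i => sumv_pi (\sum_(i <- s) U i)%VS i v).
  by move=> i; apply: memv_sum_pi.
by rewrite sumv_pi_uniq_sum // (_ : filter _ _ = s) // filter_predT.
Qed.

Lemma directv_seqP (s : seq I) : uniq s ->
  directv (\sum_(i <- s) U i) <->
  (forall u : I -> V, (forall i, u i \in U i) -> \sum_(i <- s) u i = 0 ->
     forall i, i \in s -> u i = 0).
Proof.
elim: s => [_|i s IH /= /andP[nis us]].
  by split=> // _; rewrite directvE /= !big_nil dimv0.
have E : directv (\sum_(j <- i :: s) U j) =
    directv (\sum_(j <- s) U j) && (U i :&: (\sum_(j <- s) U j) <= 0)%VS.
  rewrite !directvE /= !big_cons; set X := (\sum_(j <- s) U j)%VS.
  have H1 : (\dim X <= \sum_(j <- s) \dim (U j))%N by apply: dimv_leq_sum.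
  have [H2 <-] := dimv_add_leqif (U i) X.
  apply/eqP/andP => [D|[/eqP <- /eqP]] //.
  have := H2; rewrite D leq_add2l => H3.
  have e : \dim X = (\sum_(j <- s) \dim (U j))%N by apply/eqP; rewrite eqn_leq H1.
  by split; apply/eqP; rewrite ?e.
rewrite E subv0; split=> [/andP[/(IH us) D /eqP D'] u Hu|H].
  rewrite big_cons => S.
  have ui : u i = 0.
    apply/eqP; rewrite -memv0 -D' memv_cap Hu /=.
    move/eqP: S; rewrite addr_eq0 => /eqP->; rewrite memvN.
    by apply: memv_sum_seq.
  move: S; rewrite ui add0r => S j; rewrite inE => /orP[/eqP-> //|].
  exact: D.
apply/andP; split.
  apply/IH => // u Hu S j js.
  pose w k := if k \in s then u k else 0.
  have -> : u j = w j by rewrite /w js.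
  apply: H.
  - by move=> k; rewrite /w; case: ifP => //; rewrite mem0v.
  - rewrite big_cons /w (negPf nis) add0r -[RHS]S.
    by apply: eq_big_seq => k ->.
  - by rewrite inE js orbT.
rewrite -subv0; apply/subvP => v.
rewrite memv_cap memv0 => /andP[vi /memv_sum_seqP[//|u Hu ev]].
pose w k := if k == i then - v else u k.
have := H w; have -> : v = - w i by rewrite /w eqxx opprK.
rewrite oppr_eq0 => W; apply/eqP/W; last exact: mem_head.
  by move=> k; rewrite /w; case: eqP => [->|//]; rewrite memvN.
rewrite big_cons /w eqxx [in X in - v + X]ev big_seq.
rewrite [in X in - v + X](eq_bigr u) => [|k ks].
  by rewrite -big_seq -ev addNr.
by case: eqP ks => // ->; rewrite (negPf nis).
Qed.

End SeqSums.

(** * Projections onto the homogeneous components of a grading *)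

Section GradingProjections.
Variables (G : groupType) (K : fieldType) (N : nat).
Implicit Types (A : {vspace 'M[K]_N}) (Gam : G -> {vspace 'M[K]_N}).

(** Finite dimension leaves finitely many degrees, collected in [s]. Each [p g] is defined on all
    matrices with values in [Gam g], and is zero for [g] outside [s], so degrees can be shifted
    without checking membership in [s]. *)
Record projections A Gam (s : seq G) (p : G -> 'End('M[K]_N)) : Prop := {
  proj_uniq : uniq s;
  proj_mem : forall g a, p g a \in Gam g;
  proj_sum : forall a, a \in A -> \sum_(g <- s) p g a = a;
  proj_id : forall g a, a \in Gam g -> p g a = a;
  proj_neq : forall g h a, a \in Gam g -> h != g -> p h a = 0;
  proj_out : forall g a, g \notin s -> p g a = 0 }.

(** The degrees needed for a basis of [A] already exhaust [A]; directness of the sum with one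
    further degree then forces that component to be zero. *)
Lemma grading_projections A Gam : is_grading A Gam ->
  exists s p, projections A Gam s p.
Proof.
case=> GA span_A indep _.
have [s us defA] : exists2 s : seq G, uniq s & A = (\sum_(g <- s) Gam g)%VS.
  suff [s Hs] : exists s : seq G, {subset vbasis A <= (\sum_(g <- s) Gam g)%VS}.
    exists (undup s); first exact: undup_uniq.
    rewrite big_undup; last by move=> U; apply: addvv.
    apply/eqP; rewrite eqEsubv; apply/andP; split.
      by rewrite -[X in (X <= _)%VS](span_basis (vbasisP A)); apply/span_subvP.
    by elim: s {Hs} => [|g s IH]; rewrite ?big_nil ?sub0v // big_cons subv_add GA IH.
  have: {subset (vbasis A : seq _) <= A} by move=> v; apply: vbasis_mem.
  have H (l : seq 'M[K]_N) : {subset l <= A} ->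
      exists s : seq G, {subset l <= (\sum_(g <- s) Gam g)%VS}; last exact: H.
  elim: l => [|a l IH] lA; first by exists nil => v; rewrite in_nil.
  have [s Hs] : exists s : seq G, {subset l <= (\sum_(g <- s) Gam g)%VS}.
    by apply: IH => v vl; rewrite lA // inE vl orbT.
  have [s' Hs'] := span_A a (lA _ (mem_head _ _)).
  exists (s' ++ s) => v; rewrite big_cat inE => /orP[/eqP->|/Hs].
    exact: subvP (addvSl _ _) _ Hs'.
  exact: subvP (addvSr _ _) _.
have out g a : g \notin s -> a \in Gam g -> a = 0.
  move=> gs ag; have ugs : uniq (g :: s) by rewrite /= gs.
  have : a \in (\sum_(h <- s) Gam h)%VS by rewrite -defA; apply: subvP (GA g) _ ag.
  case/memv_sum_seqP => // u Hu ea.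
  pose w k := if k == g then - a else u k.
  have Hw k : w k \in Gam k by rewrite /w; case: eqP => [->|//]; rewrite memvN.
  have /(_ w Hw) W := (directv_seqP Gam ugs).1 (indep _ ugs).
  apply/eqP; rewrite -oppr_eq0; apply/eqP.
  have -> : - a = w g by rewrite /w eqxx.
  apply: W; last exact: mem_head.
  rewrite big_cons /w eqxx [in X in - X + _]ea big_seq [X in - X + _]big_seq.
  rewrite -sumrN -big_split.
  apply: big1 => k ks /=; case: eqP ks => [->|_ _]; first by rewrite (negPf gs).
  by rewrite addNr.
pose p g := sumv_pi_for defA g.
have p_mem g a : p g a \in Gam g by apply: memv_sum_pi.
have p_sum a : a \in A -> \sum_(g <- s) p g a = a.
  by move=> aA; rewrite sumv_pi_uniq_sum // (_ : filter _ _ = s) // filter_predT.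
have p_out g a : g \notin s -> p g a = 0 by move=> gs; apply: out gs (p_mem g a).
have pE g h a : a \in Gam g -> p h a = if h == g then a else 0.
  move=> ag; have [hs|hs] := boolP (h \in s); last first.
    by rewrite p_out //; case: eqP => // eh; rewrite -eh in ag; rewrite -(out h a).
  have [gs|gs] := boolP (g \in s); last by rewrite (out _ _ gs ag) linear0 if_same.
  apply/eqP; rewrite -subr_eq0; apply/eqP.
  have W := (directv_seqP Gam us).1 (indep _ us).
  apply: (W (fun h => p h a - (if h == g then a else 0))) => // [k|].
    by rewrite memvB //; case: eqP => [->|_]; rewrite ?mem0v.
  rewrite sumrB p_sum ?(subvP (GA g)) // (bigD1_seq g) //= eqxx big1 ?addr0 ?subrr //.
  by move=> k /negPf->.
exists s, p; split=> // [g a /pE->|g h a /pE-> /negPf-> //].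
by rewrite eqxx.
Qed.

Variables (A : {vspace 'M[K]_N}) (Gam : G -> {vspace 'M[K]_N}).
Variables (s : seq G) (p : G -> 'End('M[K]_N)).
Hypotheses (gradA : is_grading A Gam) (projA : projections A Gam s p).

Lemma homog_sub g a : a \in Gam g -> a \in A.
Proof. by case: gradA => GA _ _ _; apply: subvP. Qed.

Lemma homog_mul g h a b : a \in Gam g -> b \in Gam h -> a *m b \in Gam (g * h)%g.
Proof. by case: gradA => _ _ _; apply. Qed.

Lemma proj_sub g a : p g a \in A.
Proof. by apply: homog_sub (proj_mem projA g a). Qed.

Lemma proj_delta g h a : a \in Gam g -> p h a = if h == g then a else 0.
Proof.
move=> ag; case: eqP => [->|/eqP]; first exact: (proj_id projA).
exact: (proj_neq projA).
Qed.

Lemma homog_proj g a : a \in A -> (forall h, h != g -> p h a = 0) -> a \in Gam g.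
Proof.
move=> aA H; rewrite -(proj_sum projA aA) big_seq; apply: rpred_sum => h _.
by have [->|/H->] := eqVneq h g; rewrite ?mem0v ?(proj_mem projA).
Qed.

Lemma sum_proj_delta (T : nmodType) g (F : G -> T) : (g \notin s -> F g = 0) ->
  \sum_(k <- s) (if k == g then F k else 0) = F g.
Proof.
move=> Fg; have [gs|/[dup] gs /Fg->] := boolP (g \in s).
  rewrite (bigD1_seq g) ?(proj_uniq projA) //= eqxx big1 ?addr0 // => k.
  by move/negPf->.
by rewrite big_seq big1 // => k; case: eqP => // ->; rewrite (negPf gs).
Qed.

(** Only the component of [a] of degree [g * h^-1] can contribute degree [g] after multiplication by
    [b]. *)
Lemma proj_mulr g h a b : a \in A -> b \in Gam h ->
  p g (a *m b) = p (g * h^-1)%g a *m b.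
Proof.
move=> aA bh; rewrite -{1}(proj_sum projA aA) mulmx_suml linear_sum /=.
rewrite -(@sum_proj_delta _ (g * h^-1)%g (fun k => p k a *m b)) => [|k]; last first.
  by rewrite (proj_out projA) ?mul0mx.
apply: eq_bigr => k _; rewrite (proj_delta _ (homog_mul (proj_mem projA k a) bh)).
by rewrite -(can2_eq (mulgK _) (mulgVK _)) eq_sym.
Qed.

Lemma proj_mull g h a b : a \in Gam h -> b \in A ->
  p g (a *m b) = a *m p (h^-1 * g)%g b.
Proof.
move=> ah bA; rewrite -{1}(proj_sum projA bA) mulmx_sumr linear_sum /=.
rewrite -(@sum_proj_delta _ (h^-1 * g)%g (fun k => a *m p k b)) => [|k]; last first.
  by rewrite (proj_out projA) ?mulmx0.
apply: eq_bigr => k _; rewrite (proj_delta _ (homog_mul ah (proj_mem projA k b))).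
by rewrite -(can2_eq (mulKg _) (mulVKg _)) eq_sym.
Qed.

End GradingProjections.

(** * Traces of operators on matrix spaces *)

Section OperatorTrace.
Variables (K : fieldType) (N : nat).

Definition op_trace (f : 'M[K]_N -> 'M[K]_N) := \sum_i \sum_j f (delta_mx i j) i j.

Lemma op_traceC (f g : {linear 'M[K]_N -> 'M[K]_N}) :
  op_trace (f \o g) = op_trace (g \o f).
Proof.
have E (u v : {linear 'M[K]_N -> 'M[K]_N}) : op_trace (u \o v) =
    \sum_(ij : 'I_N * 'I_N) \sum_(kl : 'I_N * 'I_N)
      v (delta_mx ij.1 ij.2) kl.1 kl.2 * u (delta_mx kl.1 kl.2) ij.1 ij.2.
  rewrite /op_trace pair_bigA; apply: eq_bigr => -[i j] _ /=.
  rewrite [v _ in LHS]matrix_sum_delta pair_bigA linear_sum summxE /=.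
  by apply: eq_bigr => -[k l] _; rewrite linearZ mxE.
rewrite !E exchange_big /=; apply: eq_bigr => ij _; apply: eq_bigr => kl _.
by rewrite mulrC.
Qed.

(** A linear projection of the full matrix space onto the block triangular matrices; precomposing
    with it extends operators on the algebra to the whole space, where [op_trace] applies. *)
Definition block_upper (blk : 'I_N -> nat) (x : 'M[K]_N) :=
  \matrix_(i, j) (if (blk i <= blk j)%N then x i j else 0).

Fact block_upper_linear blk : linear (block_upper blk).
Proof.
by move=> c x y; apply/matrixP => i j; rewrite !mxE; case: ifP; rewrite ?mxE // mulr0 addr0.
Qed.

HB.instance Definition _ blk := GRing.isLinear.Build K _ _ _ (block_upper blk)
  (block_upper_linear blk).

End OperatorTrace.

(** * The radical, its annihilator and the column filtration are graded *)

Section BlockGrading.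
Variables (G : groupType) (K : fieldType) (N : nat) (blk : 'I_N -> nat).
Variables (A : {vspace 'M[K]_N}) (Gam : G -> {vspace 'M[K]_N}).
Variables (s : seq G) (p : G -> 'End('M[K]_N)).
Hypotheses (gradA : is_grading A Gam) (projA : projections A Gam s p).
Hypothesis memA :
  forall a, a \in A <-> forall i j, (blk j < blk i)%N -> a i j = 0.

(* The number of matrix units of A in row i, so that the sum of the a i i *+ c i
   is the trace of left multiplication by a on A. *)
Let c (i : 'I_N) : nat := #|[pred j | (blk i <= blk j)%N]|.
Hypothesis c_neq0 : forall i, (c i)%:R != 0 :> K.

Lemma block_mul a b : a \in A -> b \in A -> a *m b \in A.
Proof.
move=> /memA Ha /memA Hb; apply/memA => i j ji; rewrite mxE big1 // => k _.
have [ki|ik] := ltnP (blk k) (blk i); first by rewrite Ha ?mul0r.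
by rewrite Hb ?mulr0 // (leq_trans ji).
Qed.

Lemma block_delta i j : (blk i <= blk j)%N -> delta_mx i j \in A.
Proof.
move=> ij; apply/memA => k l lk; rewrite mxE.
by case: eqP lk => // ->; case: eqP => // -> /=; rewrite ltnNge ij.
Qed.

(** Left multiplication by [a] sends degree [h] to degree [g * h], so [p (g * h)] may be inserted
    after it on the image of [p h]. Cycling the trace brings the two projections together, and their
    product is zero since [g * h] differs from [h]. *)
Lemma trace_homog g a : a \in Gam g -> g != 1%g -> \sum_i a i i *+ c i = 0.
Proof.
move=> ag g1; have aA := homog_sub gradA ag.
have upA x : block_upper blk x \in A.
  by apply/memA => i j ji; rewrite mxE leqNgt ji.
have idA x : x \in A -> block_upper blk x = x.
  move=> /memA Hx; apply/matrixP => i j; rewrite mxE.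
  by case: leqP => // /Hx.
pose La : {linear 'M[K]_N -> 'M[K]_N} := mulmx a.
pose P : {linear 'M[K]_N -> 'M[K]_N} := \sum_(h <- s) p h.
have PE x : P x = \sum_(h <- s) p h x.
  by rewrite /P /= sum_lfunE.
pose U : {linear 'M[K]_N -> 'M[K]_N} := block_upper blk.
pose LaU : {linear 'M[K]_N -> 'M[K]_N} := La \o U.
have -> : \sum_i a i i *+ c i = op_trace LaU.
  apply: eq_bigr => i _; rewrite -sumr_const.
  rewrite big_mkcond /=; apply: eq_bigr => j _; rewrite !inE.
  rewrite /= mxE (bigD1 i) //= big1 => [|k ki].
    by rewrite addr0 mxE; case: ifP; rewrite ?mulr0 // mxE !eqxx mulr1.
  by rewrite mxE mxE (negPf ki) if_same mulr0.
(* [P] is the identity on [A] with values in [A]: it can be inserted and, after cycling, splits the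
   trace over the degrees in [s]. *)
have -> : op_trace LaU = op_trace (P \o LaU).
  apply: eq_bigr => i _; apply: eq_bigr => j _.
  by rewrite /= PE (proj_sum projA) // block_mul.
rewrite op_traceC.
have -> : op_trace (LaU \o P) = \sum_(h <- s) op_trace (La \o p h).
  rewrite exchange_big; apply: eq_bigr => i _ /=.
  rewrite exchange_big; apply: eq_bigr => j _ /=.
  rewrite idA; last by rewrite PE rpred_sum // => h _; apply: (proj_sub gradA projA).
  by rewrite PE mulmx_sumr summxE.
apply: big1 => h _.
have -> : op_trace (La \o p h) = op_trace (p (g * h)%g \o (La \o p h)).
  apply: eq_bigr => i _; apply: eq_bigr => j _ /=.
  by rewrite (proj_id projA (homog_mul gradA ag (proj_mem projA h _))).
rewrite op_traceC; apply: big1 => i _; apply: big1 => j _ /=.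
rewrite (proj_neq projA (proj_mem projA _ _)) ?mulmx0 ?mxE //.
by rewrite -{1}[h]mul1g (inj_eq (mulIg _)) eq_sym.
Qed.

(* The Jacobson radical of A. *)
Definition block_nil (x : 'M[K]_N) := forall i j, (blk j <= blk i)%N -> x i j = 0.

Lemma block_nil_sub x : block_nil x -> x \in A.
Proof. by move=> Hx; apply/memA => i j /ltnW/Hx. Qed.

(** For [x] in the radical, the product has zero diagonal. Conversely, a matrix unit as [y] isolates
    a single [x i j *+ c i], and [c i] is nonzero in [K]. *)
Lemma block_nilP x : x \in A ->
  block_nil x <-> (forall y, y \in A -> \sum_i (x *m y) i i *+ c i = 0).
Proof.
move=> xA; split=> [Jx y /memA yA|H i j].
  apply: big1 => i _; rewrite mxE big1 ?mul0rn // => k _.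
  have [ki|ik] := leqP (blk k) (blk i); first by rewrite Jx ?mul0r.
  by rewrite yA ?mulr0.
rewrite leq_eqVlt => /orP[/eqP e|]; last by move/memA: xA; apply.
have := H _ (block_delta (eq_leq e)); rewrite (bigD1 i) //= big1 => [|k ki].
  rewrite addr0 mxE (bigD1 j) //= big1 => [|k kj].
    rewrite addr0 mxE !eqxx mulr1 -mulr_natr => /eqP.
    by rewrite mulf_eq0 (negPf (c_neq0 i)) orbF => /eqP.
  by rewrite mxE (negPf kj) mulr0.
by rewrite mxE big1 ?mul0rn // => l _; rewrite mxE (negPf ki) andbF mulr0.
Qed.

Lemma trace_proj1 a : a \in A -> \sum_i p 1%g a i i *+ c i = \sum_i a i i *+ c i.
Proof.
move=> aA; rewrite -[in RHS](proj_sum projA aA).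
under [RHS]eq_bigr do rewrite summxE -sumrMnl.
rewrite exchange_big /=.
rewrite -(sum_proj_delta projA (F := fun k => \sum_i p k a i i *+ c i)) => [|gs].
  apply: eq_bigr => k _; case: eqP => // /eqP k1.
  by rewrite (trace_homog (proj_mem projA k a)).
by apply: big1 => i _; rewrite (proj_out projA) // mxE mul0rn.
Qed.

(** By the trace criterion, homogeneous [y] of degree [h] suffice as tests. If [g * h] is not 1 the
    trace vanishes; otherwise [p g x *m y] is the degree 1 component of [x *m y] and has the same
    trace, namely 0. *)
Lemma block_nil_graded g x : block_nil x -> block_nil (p g x).
Proof.
move=> Jx; have xA := block_nil_sub Jx.
apply/(block_nilP (proj_sub gradA projA g x)) => y yA.
rewrite -(proj_sum projA yA) mulmx_sumr.
under eq_bigr do rewrite summxE -sumrMnl.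
rewrite exchange_big big1 //= => h _.
have yh := proj_mem projA h y.
have [e|ne] := eqVneq (g * h)%g 1%g; last first.
  by apply: trace_homog ne; apply: (homog_mul gradA) yh; apply: (proj_mem projA).
have -> : g = (1 * h^-1)%g by rewrite -e mulgK.
rewrite -(proj_mulr gradA projA) // trace_proj1.
  exact: ((block_nilP xA).1 Jx _ (homog_sub gradA yh)).
exact: block_mul xA (homog_sub gradA yh).
Qed.

Definition first_rows (x : 'M[K]_N) := forall i j, (0 < blk i)%N -> x i j = 0.

Hypothesis blk0 : exists i, blk i = 0%N.

Lemma first_rows_sub x : first_rows x -> x \in A.
Proof. by move=> Hx; apply/memA => i j ji; rewrite Hx // (leq_ltn_trans _ ji). Qed.

(** Being the right annihilator of the radical is what makes this space graded. A unit
    [delta_mx k i] with [k] in the first block and [i] in a later one lies in the radical and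
    extracts row [i] of [x]. *)
Lemma first_rowsP x : first_rows x <-> (forall y, block_nil y -> y *m x = 0).
Proof.
split=> [Hx y Jy|H i j i0].
  apply/matrixP => i j; rewrite !mxE big1 // => k _.
  have [ki|ik] := leqP (blk k) (blk i); first by rewrite Jy ?mul0r.
  by rewrite Hx ?mulr0 // (leq_ltn_trans _ ik).
have [k k0] := blk0.
have := congr1 (fun M : 'M_N => M k j) (H (delta_mx k i) _).
rewrite mxE [RHS]mxE (bigD1 i) //= big1 => [|l li].
  rewrite addr0 mxE !eqxx mul1r; apply=> k' l.
  by rewrite mxE; case: eqP => // ->; case: eqP => // ->; rewrite k0 leqNgt i0.
by rewrite mxE (negPf li) andbF mul0r.
Qed.

Lemma first_rows_graded g x : first_rows x -> first_rows (p g x).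
Proof.
move=> Hx; have xA := first_rows_sub Hx.
apply/first_rowsP => y Jy; have yA := block_nil_sub Jy.
rewrite -(proj_sum projA yA) mulmx_suml big1 // => h _.
have yh := proj_mem projA h y.
have -> : g = (h^-1 * (h * g))%g by rewrite mulKg.
rewrite -(proj_mull gradA projA) //.
by rewrite (first_rowsP x).1 ?linear0 //; apply: block_nil_graded.
Qed.

Definition cols_from k (x : 'M[K]_N) := forall i j, (blk j < k)%N -> x i j = 0.

(** Downward induction on [k], starting above the last block. Right multiplication by the radical
    takes [cols_from k] into [cols_from k.+1], graded by induction; a unit [delta_mx j j'] of the
    radical with [j'] in block [k] moves an earlier column [j] to [j'], where it must vanish. *)
Lemma cols_from_graded g k x : x \in A -> cols_from k x -> cols_from k (p g x).
Proof.
have [m] : exists m, forall i, (blk i < k + m)%N.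
  exists (\sum_i (blk i).+1)%N => i; rewrite (bigD1 i) //=.
  by rewrite (leq_trans (leq_addr _ _) (leq_addl _ _)).
elim: m k x g => [|m IH] k x g km xA Hx.
  have -> : x = 0 by apply/matrixP => i j; rewrite mxE Hx // -[k]addn0.
  by rewrite linear0 => i j _; rewrite mxE.
(* When no index lies in block [k] there is no such unit, but then [cols_from k] and
   [cols_from k.+1] coincide. *)
have [/existsP[j' /eqP j'k]|nok] := boolP [exists j, blk j == k]; last first.
  have E y : cols_from k y <-> cols_from k.+1 y.
    split=> Hy i j jk; apply: Hy; last exact: ltnW.
    rewrite ltn_neqAle -ltnS jk andbT; apply: contra nok => jk'.
    by apply/existsP; exists j.
  by apply/E; apply: IH => //; [move=> i; rewrite addSnnS | apply/E].
have colsJ y z : y \in A -> cols_from k y -> block_nil z -> cols_from k.+1 (y *m z).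
  move=> yA Hy Jz i j jk; rewrite mxE big1 // => l _.
  have [jl|lj] := leqP (blk j) (blk l); first by rewrite Jz ?mulr0.
  by rewrite Hy ?mul0r // (leq_trans lj).
have pA := proj_sub gradA projA.
move=> i j jk.
have Jd : block_nil (delta_mx j j' : 'M[K]_N).
  by move=> u v; rewrite mxE; case: eqP => // ->; case: eqP => // ->; rewrite j'k leqNgt jk.
have : cols_from k.+1 (p g x *m delta_mx j j').
  have yA := block_nil_sub Jd; rewrite -(proj_sum projA yA) mulmx_sumr => u v vk.
  rewrite summxE big1 // => h _.
  have yh := proj_mem projA h (delta_mx j j').
  have -> : g = (g * h * h^-1)%g by rewrite mulgK.
  rewrite -(proj_mulr gradA projA) //; apply: (IH k.+1) => //.
  - by move=> w; rewrite addSnnS.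
  - exact: block_mul xA (homog_sub gradA yh).
  - exact: colsJ (block_nil_graded _ Jd).
move=> /(_ i j'); rewrite j'k ltnS => /(_ (leqnn _)).
rewrite mxE (bigD1 j) //= big1 => [|l lj]; last by rewrite mxE (negPf lj) mulr0.
by rewrite addr0 mxE !eqxx mulr1.
Qed.

(** * A homogeneous idempotent of minimal rank *)

Definition corner (x : 'M[K]_N) :=
  exists i j, [/\ blk i = 0%N, blk j = 0%N & x i j != 0].

Lemma sum_neq0_ex (F : G -> K) : \sum_(g <- s) F g != 0 -> exists g, F g != 0.
Proof.
have [/hasP[g _ Fg] _|/hasPn H] := boolP (has (fun g => F g != 0) s).
  by exists g.
by rewrite big_seq big1 ?eqxx // => g /H; rewrite negbK => /eqP.
Qed.

(* x |-> C *m x *m R identifies M_d(K) with e A e for the idempotent e = C *m R, so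
   the last two clauses make M_d(K) a graded division algebra. *)
Lemma primitive_idempotent : exists d (C : 'M[K]_(N, d)) (R : 'M[K]_(d, N)),
  [/\ (0 < d)%N, R *m C = 1%:M, forall i j, (0 < blk i)%N -> C i j = 0,
      C *m R \in Gam 1%g
    & forall g (Y : 'M_d), Y != 0 -> C *m Y *m R \in Gam g -> Y \in unitmx].
Proof.
have pA := proj_sub gradA projA.
(* For a matrix in [first_rows], [corner] means lying outside the radical. Descent on the rank
   reaches a minimal homogeneous one; excluded middle decides whether a smaller competitor
   exists. *)
have [g [x [xg Fx Cx minx]]] : exists g x, [/\ x \in Gam g, first_rows x, corner x
    & forall g' x', x' \in Gam g' -> first_rows x' -> corner x' -> (\rank x <= \rank x')%N].
  have [g [x [xg Fx Cx]]] : exists g x, [/\ x \in Gam g, first_rows x & corner x].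
    have [i i0] := blk0; pose x := delta_mx i i : 'M[K]_N.
    have Fx : first_rows x.
      by move=> k l; rewrite mxE; case: eqP => // ->; rewrite i0.
    have [g xg] : exists g, p g x i i != 0.
      apply: sum_neq0_ex; rewrite -summxE (proj_sum projA) ?mxE ?eqxx ?oner_eq0 //.
      exact: first_rows_sub.
    exists g, (p g x); split; [exact: (proj_mem projA)|exact: first_rows_graded|].
    by exists i, i.
  have [m] := ubnP (\rank x); elim: m g x xg Fx Cx => // m IH g x xg Fx Cx.
  rewrite ltnS => xm.
  have [[g' [x' [xg' Fx' Cx' lt]]]|H] := Classical_Prop.classic (exists g' x',
      [/\ x' \in Gam g', first_rows x', corner x' & (\rank x' < \rank x)%N]).
    exact: IH xg' Fx' Cx' (leq_trans lt xm).
  exists g, x; split=> // g' x' xg' Fx' Cx'; rewrite leqNgt; apply/negP => lt.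
  by apply: H; exists g', x'.
have xA := first_rows_sub Fx.
have Fmul (u v : 'M_N) : first_rows u -> first_rows (u *m v).
  by move=> Fu i j i0; rewrite mxE big1 // => k _; rewrite Fu ?mul0r.
(* The [(i, j)] entry of [x *m delta_mx j i *m x] is the square of [x i j], so some homogeneous
   component [a] of the unit keeps that entry nonzero. *)
have [h [a [ah Cxax]]] : exists h a, a \in Gam h /\ corner (x *m a *m x).
  have [i [j [i0 j0 xij]]] := Cx.
  have dA : delta_mx j i \in A by apply: block_delta; rewrite i0 j0.
  have [h nz] : exists h, (x *m p h (delta_mx j i) *m x) i j != 0.
    apply: sum_neq0_ex; rewrite -summxE -mulmx_suml -mulmx_sumr (proj_sum projA) //.
    rewrite mxE (bigD1 i) //= big1 => [|k ki].
      rewrite addr0 mxE (bigD1 j) //= big1 => [|k kj].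
        by rewrite addr0 mxE !eqxx mulr1 mulf_neq0.
      by rewrite mxE (negPf kj) mulr0.
    by rewrite mxE big1 ?mul0r // => l _; rewrite mxE (negPf ki) andbF mulr0.
  by exists h, (p h (delta_mx j i)); split; [apply: (proj_mem projA)|exists i, j].
have aA := homog_sub gradA ah.
pose r := \rank x.
have [X [R [xE [X' X'X] [R' RR']]]] : exists (X : 'M_(N, r)) (R : 'M_(r, N)),
    [/\ X *m R = x, exists X', X' *m X = 1%:M & exists R', R *m R' = 1%:M].
  exists (col_base x), (row_base x); split; first exact: mulmx_base.
    by apply/row_fullP; apply: col_base_full.
  by apply/row_freeP; apply: row_base_free.
pose B := R *m a *m X.
(* The product [x *m a *m x = X *m B *m R] is homogeneous with a corner entry, so minimality gives
   it rank at least [r], and the square matrix [B] is invertible. *)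
have Bu : B \in unitmx.
  rewrite -row_free_unit -row_leq_rank.
  have := minx _ _ (homog_mul gradA (homog_mul gradA xg ah) xg) _ Cxax.
  rewrite -mulmxA => /(_ (Fmul _ _ Fx)) /leq_trans; apply.
  have -> : x *m (a *m x) = X *m B *m R by rewrite -{1 2}xE /B !mulmxA.
  by rewrite (leq_trans (mxrankM_maxl _ _)) ?mxrankM_maxr.
pose C := a *m X *m invmx B.
have RC : R *m C = 1%:M by rewrite /C !mulmxA mulmxV.
have FX i j : (0 < blk i)%N -> X i j = 0.
  move=> i0; rewrite -[X]mulmx1 -RR' mulmxA xE mxE big1 // => k _.
  by rewrite Fx ?mul0r.
have FC i j : (0 < blk i)%N -> C i j = 0.
  move=> i0; rewrite mxE big1 // => k _; rewrite mxE big1 ?mul0r // => l _.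
  have [l0|l0] := posnP (blk l); last by rewrite FX ?mulr0.
  by have /memA -> := aA; rewrite ?mul0r // l0.
have CB : C *m B = a *m X by rewrite /C mulmxKV.
clearbody C B.
have FCM (Z : 'M_(r, N)) : first_rows (C *m Z).
  by move=> i j i0; rewrite mxE big1 // => k _; rewrite FC ?mul0r.
exists r, C, R; split=> //.
- rewrite lt0n mxrank_eq0; apply/eqP => x0.
  by have [i [j [_ _]]] := Cx; rewrite x0 mxE eqxx.
(* [z] is homogeneous and fixed by [C *m R], hence by the degree 1 component of [C *m R]. That
   component is [b *m X *m R], as [C *m R] is a left multiple of the homogeneous [x]; cancelling
   [B *m R] gives [b *m X = C]. *)
- pose z := C *m B *m R.
  have zE : z = a *m x by rewrite /z CB -mulmxA xE.
  have zh : z \in Gam (h * g)%g by rewrite zE (homog_mul gradA).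
  have eA : C *m R \in A := first_rows_sub (FCM _).
  have ez : C *m R *m z = z by rewrite /z -!mulmxA (mulmxA R C) RC mul1mx.
  pose b := p (1 * g^-1)%g (C *m X').
  have pe : p 1%g (C *m R) = b *m X *m R.
    rewrite -mulmxA xE /b -(proj_mulr gradA projA) //; last exact: first_rows_sub (FCM _).
    by rewrite -{1}xE (mulmxA _ X R) -(mulmxA C) X'X mulmx1.
  have pez : p 1%g (C *m R) *m z = z.
    rewrite -[1%g](mulgV (h * g)%g) -(proj_mulr gradA projA) // ez.
    exact: (proj_id projA).
  have bX : b *m X = C.
    move: pez; rewrite pe /z -(mulmxA (b *m X)) -(mulmxA C) (mulmxA R) RC mul1mx.
    move/(congr1 (fun u => u *m R' *m invmx B)).
    by rewrite -!(mulmxA _ (_ *m R)) -!(mulmxA B R) RR' !mulmx1 !mulmxK.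
  by rewrite -bX -pe (proj_mem projA).
move=> g' Y Y0 Yg'; rewrite -row_free_unit -row_leq_rank.
(* Minimality applies once there is a corner entry. There is one because [C *m Y *m R *m C = C *m Y]
   is nonzero and [C] vanishes outside the first block of rows. *)
suff CY : corner (C *m Y *m R).
  have := minx _ _ Yg' _ CY; rewrite -{1}mulmxA => /(_ (FCM _)) /leq_trans; apply.
  by rewrite (leq_trans (mxrankM_maxl _ _)) ?mxrankM_maxr.
have [i [j nz]] : exists i j, (C *m Y *m R *m C) i j != 0.
  have /matrix0Pn[i [j nz]] : C *m Y != 0.
    apply: contra Y0 => /eqP CY0.
    by rewrite -[Y]mul1mx -RC -mulmxA CY0 mulmx0.
  by exists i, j; rewrite -[_ *m R *m C]mulmxA RC mulmx1.
have i0 : blk i = 0%N.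
  case: (posnP (blk i)) nz => // i0; rewrite mxE big1 ?eqxx // => k _.
  by rewrite -mulmxA FCM ?mul0r.
have [/existsP[k /andP[/eqP k0 nzk]]|/existsPn H] := boolP
    [exists k, (blk k == 0%N) && ((C *m Y *m R) i k != 0)]; first by exists i, k.
move: nz; rewrite mxE big1 ?eqxx // => k _.
have [k0|k0] := posnP (blk k); last by rewrite FC ?mulr0.
by have := H k; rewrite k0 /= negbK => /eqP->; rewrite mul0r.
Qed.

End BlockGrading.

(** * Block triangularity through flags of row spaces *)

Section Flags.
Variables (K : fieldType) (N : nat) (blk : 'I_N -> nat).

Definition flagmx k : 'M[K]_N := \matrix_(i, j) ((i == j) && (k <= blk i)%N)%:R.

Lemma mulmx_flag m k (X : 'M_(m, N)) i j :
  (X *m flagmx k) i j = if (k <= blk j)%N then X i j else 0.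
Proof.
rewrite mxE (bigD1 j) //= big1 => [|l lj]; rewrite mxE.
  by rewrite eqxx addr0; case: ifP; rewrite ?mulr1 ?mulr0.
by rewrite (negPf lj) mulr0.
Qed.

Lemma mulflag_mx m k (X : 'M_(N, m)) i j :
  (flagmx k *m X) i j = if (k <= blk i)%N then X i j else 0.
Proof.
rewrite mxE (bigD1 i) //= big1 => [|l li]; rewrite mxE.
  by rewrite eqxx addr0; case: ifP; rewrite ?mul1r ?mul0r.
by rewrite eq_sym (negPf li) mul0r.
Qed.

Lemma sub_flagmxP m k (X : 'M_(m, N)) :
  (X <= flagmx k)%MS <-> forall i j, (blk j < k)%N -> X i j = 0.
Proof.
split=> [/submxP[Y ->] i j jk|H]; first by rewrite mulmx_flag leqNgt jk.
apply/submxP; exists X; apply/matrixP => i j; rewrite mulmx_flag.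
by case: leqP => // /H.
Qed.

Lemma flagmxS k : (flagmx k.+1 <= flagmx k)%MS.
Proof.
apply/sub_flagmxP => i j jk; rewrite mxE; case: eqP => //= ->.
by rewrite ltnNge (ltnW jk).
Qed.

(** Block triangularity as stability of a flag, a condition that a change of basis carries from one
    flag to another. *)
Lemma block_upper_flagP (X : 'M[K]_N) :
  (forall i j, (blk j < blk i)%N -> X i j = 0) <->
  (forall k, (flagmx k *m X <= flagmx k)%MS).
Proof.
split=> [H k|H i j ji].
  apply/sub_flagmxP => i j jk; rewrite mulflag_mx; case: ifP => // ki.
  by rewrite H // (leq_trans jk).
have /sub_flagmxP/(_ i j ji) := H (blk i).
by rewrite mulflag_mx leqnn.
Qed.

Lemma flagmx0 : flagmx 0 = 1%:M.
Proof. by apply/matrixP => i j; rewrite !mxE andbT. Qed.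

Lemma flagmx_eq0 k : (forall i, (blk i < k)%N) -> flagmx k = 0.
Proof.
by move=> H; apply/matrixP => i j; rewrite !mxE leqNgt H andbF.
Qed.

Lemma rank_flagmxS k : (exists i, blk i = k) ->
  (\rank (flagmx k.+1) < \rank (flagmx k))%N.
Proof.
case=> i ik; rewrite ltn_neqAle mxrankS ?flagmxS // andbT.
rewrite (mxrank_leqif_sup (flagmxS k)); apply/negP => /sub_flagmxP/(_ i i).
by rewrite ik ltnSn => /(_ isT)/eqP; rewrite mxE ik eqxx leqnn oner_eq0.
Qed.

End Flags.

(** * Homogeneous bases over the graded division algebra *)

Section GradedRows.
Variables (G : groupType) (K : fieldType) (N : nat).
Variables (A : {vspace 'M[K]_N}) (Gam : G -> {vspace 'M[K]_N}).
Variables (s : seq G) (p : G -> 'End('M[K]_N)).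
Hypotheses (gradA : is_grading A Gam) (projA : projections A Gam s p).
Variables (d : nat) (C : 'M[K]_(N, d)) (R : 'M[K]_(d, N)).
Hypotheses (d_gt0 : (0 < d)%N) (RC : R *m C = 1%:M).
Hypothesis CA : forall Y : 'M_(d, N), C *m Y \in A.
Hypothesis CR1 : C *m R \in Gam 1%g.
Hypothesis divD :
  forall g (Y : 'M_d), Y != 0 -> C *m Y *m R \in Gam g -> Y \in unitmx.

(** [Y |-> C *m Y] identifies the [d] by [N] matrices with the right ideal generated by [C *m R];
    this is [p g] read through that identification. *)
Definition row_part g (Y : 'M_(d, N)) := R *m p g (C *m Y).

(** The idempotent [C *m R] has degree 1, so [p g] commutes with left multiplication by it. *)
Lemma mul_row_part g Y : C *m row_part g Y = p g (C *m Y).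
Proof.
rewrite /row_part mulmxA; have := proj_mull gradA projA g CR1 (CA Y).
by rewrite -(mulmxA C R (C *m Y)) (mulmxA R C Y) RC mul1mx invg1 mul1g.
Qed.

Lemma sum_row_part Y : \sum_(g <- s) row_part g Y = Y.
Proof. by rewrite -mulmx_sumr (proj_sum projA) // mulmxA RC mul1mx. Qed.

Lemma row_part_homog g Y : C *m row_part g Y \in Gam g.
Proof. by rewrite mul_row_part (proj_mem projA). Qed.

Definition mx_part g (x : 'M_d) := R *m p g (C *m x *m R) *m C.

Lemma mul_mx_part g x : C *m mx_part g x *m R = p g (C *m x *m R).
Proof.
have xA : C *m x *m R \in A by rewrite -mulmxA CA.
have H1 := proj_mull gradA projA g CR1 xA.
have H2 := proj_mulr gradA projA g xA CR1.
rewrite /mx_part !mulmxA -(mulmxA _ C R).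
move: H1 H2; rewrite invg1 mul1g mulg1 !mulmxA -(mulmxA C R C) RC mulmx1 => <-.
by rewrite -(mulmxA _ R C) RC mulmx1 => <-.
Qed.

Lemma sum_mx_part x : \sum_(g <- s) mx_part g x = x.
Proof.
rewrite -mulmx_suml -mulmx_sumr (proj_sum projA); last by rewrite -mulmxA CA.
by rewrite !mulmxA RC mul1mx -mulmxA RC mulmx1.
Qed.

Lemma mx_part_homog g x : C *m mx_part g x *m R \in Gam g.
Proof. by rewrite mul_mx_part (proj_mem projA). Qed.

Lemma row_part_mul g h x w : C *m w \in Gam h ->
  row_part g (x *m w) = mx_part (g * h^-1)%g x *m w.
Proof.
move=> wh; have xA : C *m x *m R \in A by rewrite -mulmxA CA.
rewrite /row_part /mx_part -[RHS]mulmxA -[RHS]mulmxA -(proj_mulr gradA projA) //.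
by rewrite !mulmxA -(mulmxA _ R C) RC mulmx1.
Qed.

Definition graded_rows (U : 'M[K]_N) :=
  forall g (Y : 'M_(d, N)), (Y <= U)%MS -> (row_part g Y <= U)%MS.

(** If [v *m w] lies in [U], so does [x *m w] with all rows of [x] equal to [v], and so do the
    products of [w] with the homogeneous components of [x]. A nonzero component is invertible, which
    would put [w] itself in [U]. *)
Lemma homog_free U h w : graded_rows U -> C *m w \in Gam h -> ~~ (w <= U)%MS ->
  forall v : 'rV_d, (v *m w <= U)%MS -> v = 0.
Proof.
move=> gU wh wU v vU; apply: contraNeq wU => v0.
pose x : 'M_d := const_mx 1 *m v.
have xU : (x *m w <= U)%MS by rewrite -mulmxA (submx_trans (submxMl _ _)).
have [/hasP[g _ xg]|/hasPn x0] := boolP (has (fun g => mx_part g x != 0) s).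
  have := gU (g * h)%g _ xU; rewrite (row_part_mul _ _ wh) mulgK.
  have xu := divD xg (mx_part_homog g x).
  move=> /(submx_trans (submxMl (invmx (mx_part g x)) _)).
  by rewrite mulKmx.
have x0' : x = 0.
  rewrite -(sum_mx_part x) big_seq; apply: big1 => g /x0.
  by rewrite negbK => /eqP.
case/negP: v0; apply/eqP/rowP => j.
have := congr1 (fun M : 'M_d => M (Ordinal d_gt0) j) x0'.
by rewrite !mxE big_ord1 mxE mul1r.
Qed.

Lemma homog_rank U h w : graded_rows U -> C *m w \in Gam h -> ~~ (w <= U)%MS ->
  \rank (U + w)%MS = (\rank U + d)%N.
Proof.
move=> gU wh wU; have free_w := homog_free gU wh wU.
rewrite mxrank_disjoint_sum; last first.
  apply/eqP/rowV0P => v; rewrite sub_capmx => /andP[vU /submxP[y vy]].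
  by rewrite vy (free_w y) ?mul0mx // -vy.
congr (_ + _)%N; apply/eqP; rewrite -/(row_free w) -kermx_eq0.
by apply/rowV0P => v /sub_kermxP vw; apply: free_w; rewrite vw sub0mx.
Qed.

Lemma graded_rows_add U h w : graded_rows U -> C *m w \in Gam h ->
  graded_rows (U + w)%MS.
Proof.
move=> gU wh g Y /sub_addsmxP[[u v] /= ->].
have -> : row_part g (u *m U + v *m w) = row_part g (u *m U) + row_part g (v *m w).
  by rewrite /row_part mulmxDr linearD mulmxDr.
apply: addmx_sub_adds; first by apply: gU; apply: submxMl.
by rewrite (row_part_mul _ _ wh) submxMl.
Qed.

(** While [U'] is not inside [U], some homogeneous component coming from a row of [U'] lies outside
    [U]; adjoining it keeps the space graded and raises the rank by exactly [d]. *)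
Lemma graded_rows_basis U U' : graded_rows U -> graded_rows U' -> (U <= U')%MS ->
  exists ws : seq (G * 'M_(d, N)),
    [/\ forall w, w \in ws -> C *m w.2 \in Gam w.1 /\ (w.2 <= U')%MS,
        (U' <= U + \sum_(w <- ws) <<w.2>>)%MS
      & \rank U' = (\rank U + size ws * d)%N].
Proof.
move=> gU gU'; have [m] := ubnP (\rank U' - \rank U).
elim: m U gU => // m IH U gU; rewrite ltnS => rm UU'.
have [U'U|nU'U] := boolP (U' <= U)%MS.
  exists [::]; split=> //; first by rewrite big_nil addsmx0.
  by rewrite mul0n addn0; apply/eqP; rewrite eqn_leq !mxrankS.
have [g [w [wg wU' wU]]] : exists g w, [/\ C *m w \in Gam g, (w <= U')%MS & ~~ (w <= U)%MS].
  have /row_subPn[i iU] := nU'U.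
  (* The row is repeated [d] times because degrees are defined for [d] by [N] matrices only. *)
  pose Y : 'M_(d, N) := const_mx 1 *m row i U'.
  have YU' : (Y <= U')%MS by rewrite (submx_trans (submxMl _ _)) // row_sub.
  have [/hasP[g _ Yg]|/hasPn Yn] := boolP (has (fun g => ~~ (row_part g Y <= U)%MS) s).
    exists g, (row_part g Y); split=> //; [exact: row_part_homog|exact: gU'].
  case/negP: iU; have YU : (Y <= U)%MS.
    rewrite -(sum_row_part Y) big_seq; apply: summx_sub => g /Yn.
    by rewrite negbK.
  have -> : row i U' = row (Ordinal d_gt0) Y.
    by apply/rowP => j; rewrite !mxE big_ord1 !mxE mul1r.
  exact: submx_trans (row_sub _ _) YU.
have rk := homog_rank gU wg wU.
have U1U' : (U + w <= U')%MS by rewrite addsmx_sub UU'.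
have [||ws [Hws sub rkU']] := IH (U + w)%MS (graded_rows_add gU wg).
- rewrite rk; apply: leq_trans rm; have := mxrankS U1U'; rewrite rk => le.
  have lt : (\rank U < \rank U + d)%N by rewrite -[ltnLHS]addn0 ltn_add2l.
  by apply: ltn_sub2l => //; apply: leq_trans lt le.
- by [].
exists ((g, w) :: ws); split.
- by move=> w'; rewrite inE => /orP[/eqP->|/Hws].
- rewrite big_cons /= addsmxA; apply: submx_trans sub _.
  by rewrite addsmxS // addsmxS // genmxE.
- by rewrite rkU' rk /= mulSn addnA.
Qed.

Variables (t : nat) (blk : 'I_N -> nat).
Hypothesis blk_lt : forall i, (blk i < t)%N.
Hypothesis blk_surj : forall k : 'I_t, exists i, blk i = k.
Hypothesis graded_flag : forall k, graded_rows (flagmx K blk k).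

(** The new block size [n' k] is the size of a homogeneous basis of step [k] of the flag modulo step
    [k.+1]; stacking these bases matches the two coordinate flags. *)
Lemma adapted_homog_basis :
  exists (n' : 'I_t -> nat) (W : 'I_(\sum_i n' i) -> 'M[K]_(d, N))
    (h : 'I_(\sum_i n' i) -> G) (P : 'M[K]_((\sum_i n' i) * d, N))
    (Q : 'M[K]_(N, (\sum_i n' i) * d)),
  let blk' i := tagnat.sig1 (@mxtens_unindex (\sum_i n' i) d i).1 : nat in
  [/\ forall i, (0 < n' i)%N,
      forall l, C *m W l \in Gam (h l)
        /\ rowsub (fun a => mxtens_index (l, a)) P = W l,
      P *m Q = 1%:M, Q *m P = 1%:M
    & forall k, (flagmx K blk k <= flagmx K blk' k *m P)%MS
        /\ (flagmx K blk' k *m P <= flagmx K blk k)%MS].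
Proof.
pose F k := flagmx K blk k.
have /fin_all_exists[ws Hws] (k : 'I_t) : exists ws : seq (G * 'M_(d, N)),
    [/\ forall w, w \in ws -> C *m w.2 \in Gam w.1 /\ (w.2 <= F k)%MS,
        (F k <= F k.+1 + \sum_(w <- ws) <<w.2>>)%MS
      & \rank (F k) = (\rank (F k.+1) + size ws * d)%N].
  by apply: graded_rows_basis; rewrite ?flagmxS //; apply: graded_flag.
pose n' k := size (ws k); pose m := \sum_i n' i.
pose w (l : 'I_m) := nth (1%g, 0) (ws (tagnat.sig1 l)) (tagnat.sig2 l).
have w_in l : w l \in ws (tagnat.sig1 l) by rewrite mem_nth // ltn_ord.
have w_Rank k (x : 'I_(n' k)) : w (tagnat.Rank k x) = nth (1%g, 0) (ws k) x.
  by rewrite /w (congr1 val (tagnat.Rank2K x)) /= tagnat.Rank1K.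
pose P : 'M[K]_(m * d, N) :=
  \matrix_(i, j) (w (mxtens_unindex i).1).2 (mxtens_unindex i).2 j.
pose blk' i := tagnat.sig1 (@mxtens_unindex m d i).1 : nat.
pose F' k := flagmx K blk' k.
have F'P k : (F' k *m P <= F k)%MS.
  apply/sub_flagmxP => i j jk; rewrite mulflag_mx mxE; case: ifP => // ki.
  have [/(_ _ (w_in _))[_ /sub_flagmxP] -> //] := Hws (tagnat.sig1 (mxtens_unindex i).1).
  exact: leq_trans jk ki.
have F_t : F t = 0 by apply: flagmx_eq0.
(* Downward induction from [F t = 0]: step [k] is generated by step [k.+1] and the rows of the
   members of [ws k]. *)
have FP k : (F k <= F' k *m P)%MS.
  have [kt|tk] := leqP k t; last first.
    rewrite /F flagmx_eq0 ?sub0mx // => i; exact: ltn_trans (blk_lt i) tk.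
  rewrite -(subKn kt); elim: (t - k)%N (leq_subr k t) => [|e IH] et.
    by rewrite subn0 F_t sub0mx.
  have lt : (t - e.+1 < t)%N by rewrite ltn_subrL (leq_ltn_trans _ et).
  have [Hw sub _] := Hws (Ordinal lt); apply: submx_trans sub _.
  rewrite addsmx_sub /= -subSn // subSS; apply/andP; split.
    apply: submx_trans (IH (ltnW et)) _; apply: submxMr.
    by rewrite -[in X in (X <= _)%MS](subSS e) subSn // flagmxS.
  rewrite big_seq; apply: (big_ind (fun X => (X <= _)%MS)) => [|X Y XS YS|v vin].
  - exact: sub0mx.
  - by rewrite addsmx_sub XS.
  rewrite genmxE.
  apply/row_subP => a; have ltv : (index v (ws (Ordinal lt)) < n' (Ordinal lt))%N.
    by rewrite /n' index_mem.
  pose i := mxtens_index (tagnat.Rank _ (Ordinal ltv), a).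
  suff -> : row a v.2 = row i (F' (t - e.+1)%N *m P) by apply: row_sub.
  apply/rowP => j; rewrite mxE [RHS]mxE mulflag_mx /blk' mxtens_indexK /= tagnat.Rank1K leqnn.
  by rewrite mxE mxtens_indexK w_Rank nth_index.
have rkF : \rank (F 0%N) = (m * d)%N.
  have E k : (k <= t)%N -> \rank (F (t - k)%N) = (\sum_(i < t | (t - k <= i)%N) n' i * d)%N.
    elim: k => [|k IH] kt.
      by rewrite subn0 F_t mxrank0 big1 // => i; rewrite leqNgt ltn_ord.
    have lt : (t - k.+1 < t)%N by rewrite ltn_subrL (leq_ltn_trans _ kt).
    have Sk : (t - k.+1).+1 = (t - k)%N by rewrite subnSK.
    have [_ _ /=] := Hws (Ordinal lt); rewrite Sk => ->.
    rewrite (IH (ltnW kt)) addnC [RHS](bigD1 (Ordinal lt)) //=; congr (_ + _)%N.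
    apply: eq_bigl => i; rewrite -Sk -val_eqE /=.
    by rewrite ltn_neqAle eq_sym andbC.
  by rewrite -{1}(subnn t) E // subnn big_distrl.
have N_E : N = (m * d)%N by rewrite -rkF /F flagmx0 mxrank1.
have fullP : row_full P.
  by rewrite -sub1mx -(flagmx0 K blk) (submx_trans (FP 0%N)) // submxMl.
have [Q QP] := row_fullP fullP.
(* [N] and [m * d] are equal but not convertible, so [P] is not literally square: the rank count
   gives a right inverse, which must agree with the left inverse [Q]. *)
have PQ : P *m Q = 1%:M.
  have /row_freeP[Q' PQ'] : row_free P by apply/eqP; apply: etrans (eqP fullP) N_E.
  by rewrite -[Q]mulmx1 -PQ' (mulmxA Q) QP mul1mx.
exists n', (fun l => (w l).2), (fun l => (w l).1), P, Q; split=> //.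
(* The flag drops strictly at [k], since [blk_surj] makes every block nonempty. *)
- move=> k; rewrite lt0n; apply/negP => /eqP k0.
  have [_ _] := Hws k; rewrite -/(n' k) k0 mul0n addn0 => e.
  by have := rank_flagmxS K (blk_surj k); rewrite -/(F k) -/(F k.+1) e ltnn.
- move=> l; split; first by have [/(_ _ (w_in l))[]] := Hws (tagnat.sig1 l).
  by apply/matrixP => a j; rewrite !mxE mxtens_indexK.
Qed.

End GradedRows.

(** * Entrywise descriptions of [UT] and of its tensor product *)

Section DeltaSpan.
Variables (K : fieldType) (N : nat).

Definition delta_span (r : rel 'I_N) : {vspace 'M[K]_N} :=
  (\sum_(ij : 'I_N * 'I_N | r ij.1 ij.2) <[delta_mx ij.1 ij.2]>)%VS.

Lemma mem_delta_span r M :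
  M \in delta_span r <-> forall i j, ~~ r i j -> M i j = 0.
Proof.
split=> [/memv_sumP[u Hu ->] i j nr|H].
  rewrite summxE big1 // => -[k l] /= rkl; have /vlineP[c ->] := Hu (k, l) rkl.
  rewrite !mxE /=; case: eqP => [ik|]; last by rewrite mulr0.
  case: eqP => [jl|]; last by rewrite mulr0.
  by rewrite ik jl rkl in nr.
rewrite [M]matrix_sum_delta rpred_sum // => i _; rewrite rpred_sum // => j _.
have [rij|/H->] := boolP (r i j); last by rewrite scale0r mem0v.
rewrite memvZ //; apply: (subvP (sumv_sup (i, j) _ (subvv _))) => //.
exact: memv_line.
Qed.

End DeltaSpan.

Section UTEntries.
Variables (K : fieldType) (t : nat) (n : 'I_t -> nat).

Lemma mem_UT_sig1 M :
  M \in UT K n <-> forall i j, (tagnat.sig1 j < tagnat.sig1 i)%N -> M i j = 0.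
Proof.
split=> [/mem_UT H i j ji|H]; last first.
  apply/mem_UT => i j ji; apply/matrixP => a b; rewrite !mxE H //.
  by rewrite !tagnat.Rank1K.
have /matrixP/(_ (tagnat.sig2 i) (tagnat.sig2 j)) := H _ _ ji.
by rewrite !mxE !tagnat.sig2K.
Qed.

Lemma delta_UT i j :
  (delta_mx i j \in UT K n) = (tagnat.sig1 i <= tagnat.sig1 j)%N.
Proof.
apply/idP/idP => [/mem_UT_sig1 H|ij].
  rewrite leqNgt; apply/negP => /H/eqP; rewrite mxE !eqxx oner_eq0 //.
apply/mem_UT_sig1 => k l lk; rewrite mxE; case: eqP lk => // ->.
by case: eqP => // ->; rewrite ltnNge ij.
Qed.

(** Kronecker products of matrix units are matrix units, and the block of an index pair is that of
    its first component. *)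
Lemma mem_tensv_UT d (X : 'M[K]_((\sum_i n i) * d)) :
  X \in tensv (UT K n) fullv <->
  (forall i j, (tagnat.sig1 (mxtens_unindex j).1 < tagnat.sig1 (mxtens_unindex i).1)%N ->
     X i j = 0).
Proof.
split=> [|H].
  pose r (i j : 'I_((\sum_i n i) * d)) :=
    (tagnat.sig1 (mxtens_unindex i).1 <= tagnat.sig1 (mxtens_unindex j).1)%N.
  suff /subvP sub : (tensv (UT K n) fullv <= delta_span K r)%VS.
    by move=> /sub/mem_delta_span H i j ji; apply: H; rewrite /r -ltnNge.
  apply/span_subvP => _ /allpairsP[[x y] /= [xU _ ->]].
  apply/mem_delta_span => i j; rewrite /r -ltnNge => ji.
  by have /mem_UT_sig1 Hx := vbasis_mem xU; rewrite mxE Hx ?mul0r.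
rewrite [X]matrix_sum_delta rpred_sum // => i _; rewrite rpred_sum // => j _.
case: (leqP (tagnat.sig1 (mxtens_unindex i).1) (tagnat.sig1 (mxtens_unindex j).1)); last first.
  by move=> /H->; rewrite scale0r mem0v.
case: (mxtens_indexP i) => i' a; case: (mxtens_indexP j) => j' b.
rewrite !mxtens_indexK /= => ij; rewrite memvZ //.
have -> : delta_mx (mxtens_index (i', a)) (mxtens_index (j', b)) =
    delta_mx i' j' *t delta_mx a b :> 'M[K]_((\sum_i n i) * d).
  apply/matrixP => k l; case: (mxtens_indexP k) => k1 k2; case: (mxtens_indexP l) => l1 l2.
  rewrite tensmxE !mxE !(can_eq (@mxtens_indexK _ _)) !xpair_eqE.
  by do !case: eqP => //=; rewrite ?mulr0 ?mul0r ?mulr1.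
by rewrite mem_tensv ?memvf // delta_UT.
Qed.

(** The matrices supported on one row of the first block form a copy of the row space inside
    [UT]. *)
Lemma dim_UT_ge : (0 < t)%N -> (forall i, (0 < n i)%N) -> (\sum_i n i <= \dim (UT K n))%N.
Proof.
move=> t0 n0.
have [i0 i0E] : exists i : 'I_(\sum_i n i), tagnat.sig1 i = 0%N :> nat.
  by exists (tagnat.Rank (Ordinal t0) (Ordinal (n0 _))); rewrite tagnat.Rank1K.
pose f : 'Hom('rV[K]_(\sum_i n i), 'M[K]_(\sum_i n i)) :=
  linfun (mulmx (delta_mx i0 0)).
have fE v : f v = delta_mx i0 0 *m v by rewrite lfunE.
have /dimvS : (limg f <= UT K n)%VS.
  apply/subvP => _ /memv_imgP[v _ ->]; rewrite fE; apply/mem_UT_sig1 => i j ji.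
  rewrite mxE big_ord1 mxE; case: eqP ji => [->|]; first by rewrite i0E.
  by rewrite mul0r.
rewrite limg_dim_eq ?dimvf /dim /= ?mul1n //.
apply/eqP; rewrite -subv0; apply/subvP => v; rewrite memv_cap memv0 => /andP[_].
rewrite memv_ker fE => /eqP H; apply/eqP/rowP => j.
have := congr1 (fun M : 'M_(_) => M i0 j) H.
by rewrite mxE big_ord1 mxE !eqxx mul1r !mxE.
Qed.

End UTEntries.

(** * Constructions of gradings and the condition on the characteristic *)

Section GradingConstructions.
Variables (G : groupType) (K : fieldType).

Lemma directv_inj (V V' : vectType K) (phi : V -> V')
    (U : G -> {vspace V}) (U' : G -> {vspace V'}) :
  linear phi -> (forall x, phi x = 0 -> x = 0) ->
  (forall g x, x \in U g -> phi x \in U' g) ->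
  (forall s : seq G, uniq s -> directv (\sum_(g <- s) U' g)) ->
  forall s : seq G, uniq s -> directv (\sum_(g <- s) U g).
Proof.
move=> lphi phi0 UU' dU' s us.
pose phiL := HB.pack_for {linear V -> V'} phi (GRing.isLinear.Build K V V' _ phi lphi).
have phiE : phi = phiL by [].
apply/directv_seqP => // u Hu S g gs; apply: phi0.
have := (directv_seqP U' us).1 (dU' s us) (fun g => phi (u g)); apply=> //.
  by move=> h; apply: UU'.
by rewrite phiE -linear_sum S linear0.
Qed.

(** Each component is spanned by the matrix units of one degree, so directness is read entrywise:
    position [(i, j)] is occupied in degree [deg i j] only. *)
Lemma elementary_grading (t : nat) (n : 'I_t -> nat) (gs : 'I_(\sum_i n i) -> G) :
  exists GamB : G -> {vspace 'M[K]_(\sum_i n i)}, elementary (UT K n) GamB gs.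
Proof.
pose deg i j := (gs i * (gs j)^-1)%g.
pose r g : rel 'I_(\sum_i n i) :=
  fun i j => (tagnat.sig1 i <= tagnat.sig1 j)%N && (deg i j == g).
have memB g M := mem_delta_span (K := K) (r g) M.
have deltaB i j : delta_mx i j \in UT K n -> delta_mx i j \in delta_span K (r (deg i j)).
  rewrite delta_UT => ij; apply/memB => k l nr; rewrite mxE.
  case: eqP nr => // ->; case: eqP => // ->.
  by rewrite /r ij eqxx.
exists (fun g => delta_span K (r g)); split=> //; split.
- move=> g; apply/subvP => M /memB H; apply/mem_UT_sig1 => i j ji.
  by apply: H; rewrite /r leqNgt ji.
- move=> M /mem_UT_sig1 H.
  pose s := [seq deg ij.1 ij.2 | ij : 'I_(\sum_i n i) * 'I_(\sum_i n i)].
  exists s; rewrite [M]matrix_sum_delta rpred_sum // => i _; rewrite rpred_sum // => j _.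
  case: (leqP (tagnat.sig1 i) (tagnat.sig1 j)) => [ij|/H->]; last by rewrite scale0r mem0v.
  rewrite memvZ // (big_rem (deg i j)) /=; last by apply/imageP; exists (i, j).
  by apply: (subvP (addvSl _ _)); rewrite deltaB ?delta_UT.
- move=> s us; apply/directv_seqP => // u Hu S g gs0.
  apply/matrixP => i j; rewrite mxE.
  have [e|ne] := eqVneq (deg i j) g; last first.
    by have /memB -> := Hu g; rewrite // /r (negPf ne) andbF.
  have := congr1 (fun M : 'M_(_) => M i j) S.
  have E0 : \sum_(h <- s | h != g) u h i j = 0.
    apply: big1 => h hg.
    by have /memB -> := Hu h; rewrite // /r e eq_sym (negPf hg) andbF.
  by rewrite summxE (bigD1_seq g) //= E0 addr0 => ->; rewrite mxE.
- move=> g h a b /memB Ha /memB Hb; apply/memB => i j nr.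
  rewrite mxE big1 // => k _.
  have [rik|/Ha->] := boolP (r g i k); last by rewrite mul0r.
  have [rkj|/Hb->] := boolP (r h k j); last by rewrite mulr0.
  case/andP: rik => ik /eqP eg; case/andP: rkj => kj /eqP eh.
  case/negP: nr; rewrite /r (leq_trans ik kj) -eg -eh /deg mulgA mulgVK.
  exact: eqxx.
Qed.

End GradingConstructions.

(** The count is at least 1 and at most the matrix size, which is bounded by the dimension of the
    algebra and so lies below [p]. *)
Lemma block_count_neq0 (K : fieldType) (t : nat) (n : 'I_t -> nat) :
  (0 < t)%N -> (forall i, (0 < n i)%N) ->
  ([pchar K] =i pred0 \/
   exists2 p : nat, p \in [pchar K] & (\dim (UT K n) < p)%N) ->
  forall i : 'I_(\sum_i n i),
    #|[pred j | (tagnat.sig1 (p_ := n) i <= tagnat.sig1 (p_ := n) j)%N]|%:R != 0 :> K.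
Proof.
move=> t0 n0 charK i; set c := #|_|.
have c_gt0 : (0 < c)%N by apply/card_gt0P; exists i; rewrite inE.
have [/pcharf0P->|[p pK ltp]] := charK; first by rewrite -lt0n.
rewrite -(dvdn_pcharf pK) gtnNdvd // (leq_ltn_trans _ ltp) //.
by rewrite (leq_trans (max_card _)) // card_ord dim_UT_ge.
Qed.

(** * Assembly of the graded isomorphism *)

Theorem theorem5 (G : groupType) (K : fieldType) (t : nat) (n : 'I_t -> nat)
    (Gam : G -> {vspace 'M[K]_(\sum_(i < t) n i)}) :
  (0 < t)%N -> (forall i, (0 < n i)%N) ->
  is_grading (UT K n) Gam ->
  ([pchar K] =i pred0 \/
   exists2 p : nat, p \in [pchar K] & (\dim (UT K n) < p)%N) ->
  exists (d : nat) (GamD : G -> {vspace 'M[K]_d})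
         (n' : 'I_t -> nat)
         (GamB : G -> {vspace 'M[K]_(\sum_(i < t) n' i)})
         (gs : 'I_(\sum_(i < t) n' i) -> G)
         (GamT : G -> {vspace 'M[K]_((\sum_(i < t) n' i) * d)}),
    [/\ (0 < d)%N /\ graded_division GamD,
        forall i, (0 < n' i)%N,
        elementary (UT K n') GamB gs,
        tensor_grading (UT K n') gs GamD GamT
      & graded_iso (UT K n) Gam (tensv (UT K n') fullv) GamT].
Proof.
move=> t0 n0 gradA charK; pose N := \sum_(i < t) n i.
have [s [p projA]] := grading_projections gradA.
pose blk (i : 'I_N) : nat := tagnat.sig1 i.
have memA a : a \in UT K n <-> forall i j, (blk j < blk i)%N -> a i j = 0.
  exact: mem_UT_sig1.
have c_neq0 := block_count_neq0 t0 n0 charK.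
have blk_surj (k : 'I_t) : exists i, blk i = k.
  by exists (tagnat.Rank k (Ordinal (n0 k))); rewrite /blk tagnat.Rank1K.
have [d [C [R [d0 RC C0 CR1 divD]]]] :=
  primitive_idempotent gradA projA memA c_neq0 (blk_surj (Ordinal t0)).
have CA (Y : 'M_(d, N)) : C *m Y \in UT K n.
  apply/memA => i j ji; rewrite mxE big1 // => k _.
  by rewrite C0 ?mul0r // (leq_ltn_trans _ ji).
have graded_flag k : graded_rows p C R (flagmx K blk k).
  move=> g Y /sub_flagmxP Yk; apply/sub_flagmxP => i j jk.
  have H : cols_from blk k (p g (C *m Y)).
    apply: (cols_from_graded gradA projA memA c_neq0) => // i' j' j'k.
    by rewrite mxE big1 // => l' _; rewrite Yk ?mulr0.
  by rewrite mxE big1 // => l _; rewrite H ?mulr0.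
have blk_lt i : (blk i < t)%N by apply: ltn_ord.
have [n' [W [h [P [Q [n'0 HW PQ QP HF]]]]]] :=
  adapted_homog_basis gradA projA d0 RC CA CR1 divD blk_lt blk_surj graded_flag.
pose blk' i := tagnat.sig1 (@mxtens_unindex (\sum_i n' i) d i).1 : nat.
pose m := (\sum_i n' i)%N; rewrite -/m in W h P Q n'0 HW PQ QP HF *.
have fP l : C *m W l \in Gam (h l) by have [] := HW l.
have rowP' l : rowsub (fun a => mxtens_index (l, a)) P = W l by have [] := HW l.
(* [P] matches the flags of the new and the old blocks, so conjugation by it matches their
   stabilisers. *)
have mem_conj a : a \in UT K n <-> P *m a *m Q \in tensv (UT K n') fullv.
  split=> [/memA/block_upper_flagP H|/mem_tensv_UT H].
    apply/mem_tensv_UT; apply/(block_upper_flagP blk') => k.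
    rewrite !mulmxA (submx_trans (submxMr Q (submxMr a (HF k).2))) //.
    rewrite (submx_trans (submxMr Q (H k))) //.
    by rewrite (submx_trans (submxMr Q (HF k).1)) // -mulmxA PQ mulmx1.
  have {}H := (block_upper_flagP blk' _).1 H.
  apply/memA/block_upper_flagP => k.
  have aE : a = Q *m (P *m a *m Q) *m P by rewrite !mulmxA QP mul1mx -mulmxA QP mulmx1.
  rewrite aE; apply: submx_trans (HF k).2.
  rewrite !mulmxA -(mulmxA _ Q P) QP mulmx1.
  apply: submx_trans (submxMr P (H k)).
  rewrite !mulmxA -(mulmxA _ Q P) QP mulmx1 -(mulmxA _ Q P) QP mulmx1.
  exact: submxMr (HF k).1.
pose f : 'Hom('M[K]_N, 'M[K]_(m * d)) := linfun (mulmxr Q \o mulmx P).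
have fE a : f a = P *m a *m Q by rewrite lfunE.
have fK a : Q *m f a *m P = a.
  by rewrite fE !mulmxA QP mul1mx -mulmxA QP mulmx1.
have fK' b : f (Q *m b *m P) = b.
  by rewrite fE !mulmxA PQ mul1mx -mulmxA PQ mulmx1.
have f_inj : injective f by move=> a b ab; rewrite -(fK a) ab fK.
have fM a b : f (a *m b) = f a *m f b.
  by rewrite !fE -!mulmxA (mulmxA Q P) QP mul1mx.
(* Transporting the grading along [f] makes [f] graded at once; what remains is the degree of
   [delta_mx i j *t x]. *)
pose GamT g := (f @: Gam g)%VS.
have mem_GamT g b : b \in GamT g <-> Q *m b *m P \in Gam g.
  split=> [/memv_imgP[a ag ->]|bg]; first by rewrite fK.
  by rewrite -(fK' b) memv_img.
have fA : (f @: UT K n)%VS = tensv (UT K n') fullv.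
  apply/vspaceP => b; apply/idP/idP => [/memv_imgP[a aA ->]|bB].
    by rewrite fE; apply/mem_conj.
  by rewrite -(fK' b) memv_img //; apply/mem_conj; rewrite -fE fK'.
pose phi : 'Hom('M[K]_d, 'M[K]_N) := linfun (mulmxr R \o mulmx C).
have phiE x : phi x = C *m x *m R by rewrite lfunE.
pose GamD g := (phi @^-1: Gam g)%VS.
have memD g x : (x \in GamD g) = (C *m x *m R \in Gam g).
  by rewrite -phiE memv_preim.
have [GA _ dirA mulA] := gradA.
(* Pulled back to [A], [delta_mx i j *t x] sends [W i] to [x *m W j], so its degree is
   [(h i)^-1 * deg x * h j]; hence the inverse. *)
pose gs l := (h l)^-1%g.
have [GamB eltB] := elementary_grading K gs.
exists d, GamD, n', GamB, gs, GamT; split=> //.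
- split=> //; split; last by move=> g x; rewrite memD => xg x0; apply: divD x0 xg.
  split.
  + by move=> g; apply: subvf.
  + move=> x _; exists s; rewrite -(sum_mx_part projA RC CA x).
    apply: memv_sum_seq => g _; rewrite memD.
    exact: (mx_part_homog gradA projA RC CA CR1).
  + apply: (directv_inj (phi := phi) (U' := Gam)) => //.
    * exact: linearP.
    * move=> x; rewrite phiE => x0.
      have : R *m (C *m x *m R) *m C = 0 by rewrite x0 mulmx0 mul0mx.
      by rewrite !mulmxA RC mul1mx -mulmxA RC mulmx1.
    * by move=> g x; rewrite memD phiE.
  + move=> g k a b; rewrite !memD => ag bk.
    have := mulA _ _ _ _ ag bk.
    by rewrite !mulmxA -(mulmxA _ R C) RC mulmx1.
- split.
    split.
    + by move=> g; rewrite -fA; apply/limgS/GA.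
    + move=> b bB; exists s; rewrite -(fK' b).
      have aA : Q *m b *m P \in UT K n by apply/mem_conj; rewrite -fE fK'.
      rewrite -(proj_sum projA aA) linear_sum.
      by apply: memv_sum_seq => g _; rewrite memv_img ?(proj_mem projA).
    + apply: (directv_inj (phi := fun b => Q *m b *m P) (U' := Gam)) => //.
      * by move=> c x y; rewrite mulmxDr mulmxDl -scalemxAr -scalemxAl.
      * by move=> x x0; rewrite -(fK' x) x0 linear0.
      * by move=> g x /mem_GamT.
    + move=> g k _ _ /memv_imgP[a ag ->] /memv_imgP[b bk ->].
      by rewrite -fM memv_img // mulA.
  move=> i j k x ijB; rewrite memD => xk; apply/mem_GamT.
  set b := delta_mx i j *t x; set a := Q *m b *m P.
  have aA : a \in UT K n.
    by apply/mem_conj; rewrite -fE fK' mem_tensv ?memvf.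
  have Pa l : W l *m a = if l == i then x *m W j else 0.
    rewrite -rowP' mul_rowsub_mx /a !mulmxA PQ mul1mx -mul_rowsub_mx.
    have -> : rowsub (fun u => mxtens_index (l, u)) b =
        if l == i then x *m rowsub (fun u => mxtens_index (j, u)) 1%:M else 0.
      apply/matrixP => u v; case: (mxtens_indexP v) => l' v'.
      rewrite mxE tensmxE mxE; have [_|_] := eqVneq l i; last by rewrite mul0r mxE.
      rewrite mxE (bigD1 v') //= [X in _ = _ + X](_ : _ = 0).
        rewrite !mxE (can_eq (@mxtens_indexK _ _)) xpair_eqE eqxx andbT addr0.
        by rewrite mulrC eq_sym.
      apply: big1 => w wv.
      by rewrite !mxE (can_eq (@mxtens_indexK _ _)) xpair_eqE (negPf wv) andbF mulr0.
    case: eqP => _; last by rewrite mul0mx.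
    by rewrite -mulmxA mul_rowsub_mx mul1mx rowP'.
  (* Since [P] is invertible, [p g a] is zero once every [W l] kills it. As [W l] is homogeneous and
     [W l *m a] is 0 or the homogeneous [x *m W j], only the expected degree survives. *)
  apply: (homog_proj projA aA) => g ng.
  suff Pg l : W l *m p g a = 0.
    have : P *m p g a = 0.
      apply/matrixP => u v; case: (mxtens_indexP u) => l u'.
      have := congr1 (fun M : 'M_(_, _) => M u' v) (Pg l).
      by rewrite -rowP' mul_rowsub_mx !mxE.
    by move/(congr1 (mulmx Q)); rewrite mulmxA QP mul1mx mulmx0.
  have : C *m (W l *m p g a) = 0.
    have -> : g = ((h l)^-1 * (h l * g))%g by rewrite mulKg.
    rewrite mulmxA -(proj_mull gradA projA) // -mulmxA Pa.
    case: eqP => [li|_]; last by rewrite mulmx0 linear0.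
    have := mulA _ _ _ _ xk (fP j).
    rewrite !mulmxA -(mulmxA _ R C) RC mulmx1 -mulmxA => /(proj_neq projA); apply.
    apply: contra ng => /eqP e; rewrite /gs invgK -mulgA -e li mulKg.
    exact: eqxx.
  by move/(congr1 (mulmx R)); rewrite mulmxA RC mul1mx mulmx0.
exists f; split=> // a b _ _; exact: f_inj.
Qed.
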